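(* Let $c(n)$ be the number of toothpicks added at stage $n$ of the corner toothpick structure, $t(n)$ the number added at stage $n$ of the toothpick structure, and $T(n)=\sum_{i=0}^n t(i)$, with $c(0)=t(0)=0$. Then, as formal power series, $$ \sum_{n\ge0}c(n)x^n = x(1+x)\prod_{k\ge1}\left(1+x^{2^k-1}+2x^{2^k}\right), $$ $$ \sum_{n\ge0}t(n)x^n=\frac{x}{1+2x}\Big\{1+4x(1+x)\prod_{k\ge1}\left(1+x^{2^k-1}+2x^{2^k}\right)\Big\}=\frac{x}{1+2x}\Big\{1+2x\prod_{k\ge0}\left(1+x^{2^k-1}+2x^{2^k}\right)\Big\}, $$ and $$ \sum_{n\ge0}T(n)x^n=\frac{x}{(1-x)(1+2x)}\Big\{1+2x\prod_{k\ge0}\left(1+x^{2^k-1}+2x^{2^k}\right)\Big\}. $$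
   Context: A toothpick is a line segment of length $1$ in the plane. An end of a toothpick is exposed if that point is neither an end nor the midpoint of any other toothpick (or half-toothpick) in the structure. The toothpick structure: at stage $1$ place a single toothpick from $(0,-\tfrac12)$ to $(0,\tfrac12)$; at each subsequent stage, for every exposed toothpick end, place a toothpick centered at that end and perpendicular to the toothpick having that end. The corner toothpick structure: no toothpick may cross into the third quadrant $\{x<0,y<0\}$, and toothpicks may touch the negative $x$- or $y$-axis only at their ends; at stage $0$ place a half-toothpick from $(0,0)$ to $(\tfrac12,0)$; at each stage $n\ge1$, for every exposed end, place a perpendicular toothpick centered at that end whenever this respects the restrictions. *)

(* Defs.v *)
From HB Require Import structures.
From mathcomp Require Import all_boot all_order all_algebra.
From mathcomp Require Import finmap.
From mathcomp Require Import boolp reals.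

Set Implicit Arguments.
Unset Strict Implicit.
Unset Printing Implicit Defensive.

Import Order.TTheory GRing.Theory Num.Theory.
Local Open Scope ring_scope.

Record fps (A : Type) := Fps { coefs :> nat -> A }.

Lemma fpsP (A : Type) (f g : fps A) : f =1 g -> f = g.
Proof. by case: f g => f [g] /= fg; congr Fps; apply/funext. Qed.

HB.instance Definition _ (A : Type) := gen_eqMixin (fps A).
HB.instance Definition _ (A : Type) := gen_choiceMixin (fps A).

Section FpsRing.
Variable A : comNzRingType.
Implicit Types f g h : fps A.

Definition fps_add f g : fps A := Fps (fun n => f n + g n).
Definition fps_opp f : fps A := Fps (fun n => - f n).
Definition fps_zero : fps A := Fps (fun=> 0).
Definition fps_one : fps A := Fps (fun n => (n == 0)%:R).
Definition fps_mul f g : fps A := Fps (fun n => \sum_(i < n.+1) f i * g (n - i)%N).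

Fact fps_addA : associative fps_add.
Proof. by move=> f g h; apply: fpsP => n /=; rewrite addrA. Qed.

Fact fps_addC : commutative fps_add.
Proof. by move=> f g; apply: fpsP => n /=; rewrite addrC. Qed.

Fact fps_add0 : left_id fps_zero fps_add.
Proof. by move=> f; apply: fpsP => n /=; rewrite add0r. Qed.

Fact fps_addN : left_inverse fps_zero fps_opp fps_add.
Proof. by move=> f; apply: fpsP => n /=; rewrite addNr. Qed.

HB.instance Definition _ :=
  GRing.isZmodule.Build (fps A) fps_addA fps_addC fps_add0 fps_addN.

Let trunc n f : {poly A} := \poly_(i < n.+1) f i.

Let fps_mulE f g m n : (m <= n)%N ->
  fps_mul f g m = (trunc n f * trunc n g)`_m.
Proof.
move=> le_mn; rewrite coefM; apply: eq_bigr => i _; rewrite !coef_poly.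
by rewrite (leq_trans (ltn_ord i)) // ltnS (leq_trans (leq_subr _ _) le_mn).
Qed.

Fact fps_mulA : associative fps_mul.
Proof.
move=> f g h; apply: fpsP => n.
transitivity ((trunc n f * trunc n g * trunc n h)`_n); last first.
  rewrite coefM; apply: eq_bigr => i _.
  by rewrite -(fps_mulE _ _ (leq_ord i)) coef_poly ltnS leq_subr.
rewrite -mulrA coefM; apply: eq_bigr => i _.
by rewrite -(fps_mulE _ _ (leq_subr i n)) coef_poly ltn_ord.
Qed.

Fact fps_mulC : commutative fps_mul.
Proof.
by move=> f g; apply: fpsP => n; rewrite !(fps_mulE _ _ (leqnn n)) mulrC.
Qed.

Fact fps_mul1 : left_id fps_one fps_mul.
Proof.
move=> f; apply: fpsP => n /=; rewrite big_ord_recl /= mul1r subn0.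
by rewrite big1 ?addr0 // => i _; rewrite mul0r.
Qed.

Fact fps_mulDl : left_distributive fps_mul fps_add.
Proof.
move=> f g h; apply: fpsP => n /=; rewrite -big_split.
by apply: eq_bigr => i _; rewrite mulrDl.
Qed.

Fact fps_one_neq0 : fps_one != fps_zero.
Proof.
apply/eqP => /(congr1 (fun f : fps A => f 0)) /eqP.
by rewrite /= oner_eq0.
Qed.

HB.instance Definition _ := GRing.Zmodule_isComNzRing.Build (fps A)
  fps_mulA fps_mulC fps_mul1 fps_mulDl fps_one_neq0.

(* [fps_inv f] is the multiplicative inverse of [f] whenever it exists. *)
Definition fps_unit : {pred fps A} := fun f => `[< exists g, g * f = 1 >].
Definition fps_inv f : fps A :=
  if pselect (exists g, g * f = 1) is left ex then projT1 (cid ex) else f.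

Fact fps_mulV : {in fps_unit, left_inverse 1 fps_inv *%R}.
Proof.
move=> f /asboolP ex; rewrite /fps_inv; case: pselect => // ex'.
exact: projT2 (cid ex').
Qed.

Fact fps_unitPl f g : g * f = 1 -> fps_unit f.
Proof. by move=> gf; apply/asboolP; exists g. Qed.

Fact fps_inv_out : {in [predC fps_unit], fps_inv =1 id}.
Proof. by move=> f /asboolPn nex; rewrite /fps_inv; case: pselect. Qed.

HB.instance Definition _ := GRing.ComNzRing_hasMulInverse.Build (fps A)
  fps_mulV fps_unitPl fps_inv_out.

Definition fpsX : fps A := Fps (fun n => (n == 1)%:R).

(* Convergence in the X-adic topology (A being discrete). *)
Definition fps_cvg (u : nat -> fps A) (l : fps A) :=
  forall n, exists N, forall m, (N <= m)%N -> u m n = l n.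

Definition is_infprod (k0 : nat) (F : nat -> fps A) (P : fps A) :=
  fps_cvg (fun N => \prod_(k0 <= k < N) F k) P.

Lemma fps_cvg_unique u l1 l2 : fps_cvg u l1 -> fps_cvg u l2 -> l1 = l2.
Proof.
move=> u1 u2; apply: fpsP => n.
have [N1 /(_ (maxn N1 _)) e1] := u1 n; have [N2 /(_ (maxn N1 N2)) e2] := u2 n.
by rewrite -(e1 N2) ?leq_maxl // e2 ?leq_maxr.
Qed.

End FpsRing.

Section Toothpicks.
Variable R : realType.

Definition point : Type := (R * R)%type.

(* All the segments that occur are parallel to an axis: such a segment is given
   by its midpoint, whether it is horizontal, and half its length; distinct
   data with positive lengths give distinct segments. *)
Definition segment : Type := (point * bool * R)%type.

Definition midpoint (s : segment) : point := s.1.1.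
Definition horizontal (s : segment) : bool := s.1.2.
Definition halflength (s : segment) : R := s.2.

Definition shift (s : segment) (u : R) : point :=
  let: (x, y) := midpoint s in if horizontal s then (x + u, y) else (x, y + u).

Definition on_segment (s : segment) (p : point) : Prop :=
  exists2 u, `|u| <= halflength s & p = shift s u.

Definition ends (s : segment) : {fset point} :=
  [fset shift s (- halflength s); shift s (halflength s)]%fset.

Definition toothpick (p : point) (h : bool) : segment := (p, h, 1 / 2).

Definition exposed (S : {fset segment}) (s : segment) (e : point) : Prop :=
  e \in ends s /\
  forall s', s' \in S -> s' != s -> e \notin ends s' /\ e != midpoint s'.

Definition additions (allowed : segment -> Prop) (S : {fset segment}) :
    {fset segment} :=
  [fset toothpick e (~~ horizontal s) | s in S, e in ends s &
     `[< exposed S s e /\ allowed (toothpick e (~~ horizontal s)) >]]%fset.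

Definition grow allowed S := (S `|` additions allowed S)%fset.

Definition toothpick_structure (n : nat) : {fset segment} :=
  if n is m.+1 then
    iter m (grow (fun=> True)) [fset toothpick (0, 0) false]%fset
  else fset0.

Definition corner_allowed (s : segment) : Prop :=
  forall p, on_segment s p ->
    ~ (p.1 < 0 /\ p.2 < 0) /\
    (p.1 < 0 /\ p.2 = 0 \/ p.1 = 0 /\ p.2 < 0 -> p \in ends s).

(* The initial half-toothpick goes from (0, 0) to (1/2, 0); its midpoint
   (1/4, 0) is never an end of another toothpick, so that counting it as a
   midpoint in [exposed] has no effect. *)
Definition corner_structure (n : nat) : {fset segment} :=
  iter n (grow corner_allowed) [fset ((1 / 4, 0), true, 1 / 4)]%fset.

(* With [0.-1 = 0], both counts are 0 at stage 0. *)
Definition toothpick_added (n : nat) : nat :=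
  #|` toothpick_structure n `\` toothpick_structure n.-1 |%fset.

Definition corner_added (n : nat) : nat :=
  #|` corner_structure n `\` corner_structure n.-1 |%fset.

Definition toothpick_total (n : nat) : nat :=
  (\sum_(0 <= i < n.+1) toothpick_added i)%N.

End Toothpicks.

Definition genfun (a : nat -> nat) : fps int := Fps (fun n => (a n)%:Z).

(* The exponent 2 ^ k - 1 is 0 for k = 0, where the factor is 2 + 2x. *)
Definition toothpick_factor (k : nat) : fps int :=
  1 + fpsX int ^+ (2 ^ k - 1) + 2 * fpsX int ^+ (2 ^ k).

(* Main.v *)
Require Import Defs.
From mathcomp Require Import all_boot all_order all_algebra.
From mathcomp Require Import finmap zify ring lra.
From mathcomp Require Import boolp.
From mathcomp Require Import reals.
Import Order.TTheory GRing.Theory Num.Theory.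
Set Implicit Arguments.
Unset Strict Implicit.
Unset Printing Implicit Defensive.

(* Measure in half-units, so that toothpicks are centred at the points of Z^2.
   A toothpick is vertical exactly when the coordinates of its centre have an
   even sum, and the centre p can only be touched by the toothpicks centred at
   its two neighbours in the direction perpendicular to its own, the parents of
   p. Hence p is born one stage after the earlier of its parents, and never if
   the parents are born simultaneously or are both never born. This rule
   determines all birth times.

   On the first quadrant, the birth times at the points with coordinates below
   2^k determine those with coordinates below 2^(k+1): the larger square is
   completed by three copies of the smaller one around (2^k, 2^k), one of them
   reflected and one rotated, delayed by 2^(k+1) or 2^(k+1) - 1 stages.
   Checking that the result obeys the birth rule only requires knowing what
   happens on the sides of the smaller square, and there the birth times are
   explicit. The corner structure consists of the upper half of the toothpick
   structure and of one more rotated quadrant that runs one stage ahead. If Q is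
   the generating function of the births in the open quadrant, the toothpick
   structure is therefore counted by x + 2x^2 + 4Q, the corner structure by
   x + x^2 + 2Q + Q/x, and the self-similarity gives
   (1 + 2x) Q = x^2 (1 + x) (prod_(k >= 1) (1 + x^(2^k-1) + 2x^(2^k)) - 1). *)

(** * Self-similar birth times *)

Local Open Scope nat_scope.

Definition omin (a b : option nat) : option nat :=
  match a, b with
  | Some i, Some j => Some (minn i j)
  | Some i, None => Some i
  | None, _ => b
  end.

(* Birth time of a point whose parents have birth times [a] and [b]; [None]
   means never. *)
Definition newborn (a b : option nat) : option nat :=
  if a == b then None else omap succn (omin a b).

Lemma newbornC a b : newborn a b = newborn b a.
Proof.
rewrite /newborn eq_sym; case: eqP => // _.
by case: a b => [i|] [j|] //=; rewrite minnC.
Qed.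

Lemma newborn_same a : newborn a a = None.
Proof. by rewrite /newborn eqxx. Qed.

Lemma newbornN a : newborn a None = omap succn a.
Proof. by case: a. Qed.

Lemma newborn_shift c a b :
  newborn (omap (addn c) a) (omap (addn c) b) = omap (addn c) (newborn a b).
Proof.
case: a b => [i|] [j|] //=; rewrite /newborn /=; try by rewrite addnS.
rewrite !(inj_eq Some_inj) eqn_add2l; case: eqP => //= _.
by rewrite -addn_minr addnS.
Qed.

(** Positivity keeps [predn], which would identify 0 and 1, injective on the times involved. This
    serves the quadrant of the corner structure that runs one stage ahead. *)
Lemma newborn_pred a b : (forall m, a = Some m -> 0 < m) ->
  (forall m, b = Some m -> 0 < m) ->
  newborn (omap predn a) (omap predn b) = omap predn (newborn a b).
Proof.
case: a b => [i|] [j|] //= ha hb; rewrite /newborn /=.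
- have := ha _ erefl; have := hb _ erefl => j0 i0.
  rewrite !(inj_eq Some_inj).
  by do 2 case: eqP => //=; move=> *; try congr Some; lia.
- by have := ha _ erefl => i0; congr Some; lia.
- by have := hb _ erefl => j0; congr Some; lia.
Qed.

(* The birth rule, meaningful for [0 < x] and [0 < y] only, since [0.-1 = 0]. *)
Definition spread (G : nat -> nat -> option nat) (x y : nat) : option nat :=
  if odd (x + y) then newborn (G x y.-1) (G x y.+1)
  else newborn (G x.-1 y) (G x.+1 y).

(** The old block occupies [x < N], [y <= N]; clockwise around [(N, N)] follow a reflected copy, a
    translate and a rotated copy. The rotated copy starts one stage earlier because its point born
    at 2 would sit at [(N, N)], the root of the translate. *)
Definition quadruple (N : nat) (G : nat -> nat -> option nat) (x y : nat) :=
  if x < N then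
    if y <= N then G x y else omap (addn (2 * N)) (G (N - x) (y - N))
  else if N <= y then omap (addn (2 * N)) (G (x - N) (y - N))
  else omap (addn (2 * N - 1)) (G (N - y) (x - N).+1).

Fixpoint block (k : nat) : nat -> nat -> option nat :=
  if k is j.+1 then quadruple (2 ^ j) (block j)
  else fun x y => if (x, y) == (0, 0) then Some 1
                  else if (x, y) == (0, 1) then Some 2 else None.

Section Quadruple.
Variables (N : nat) (G : nat -> nat -> option nat).

Lemma quadruple_old x y : x < N -> y <= N -> quadruple N G x y = G x y.
Proof. by rewrite /quadruple => -> ->. Qed.

Lemma quadruple_nw x y a b : x + a = N -> y = N + b -> 0 < a -> 0 < b ->
  quadruple N G x y = omap (addn (2 * N)) (G a b).
Proof.
move=> ha hb a0 b0; rewrite /quadruple ifT ?ifF; try lia.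
by congr (omap _ (G _ _)); lia.
Qed.

Lemma quadruple_ne x y a b : x = N + a -> y = N + b ->
  quadruple N G x y = omap (addn (2 * N)) (G a b).
Proof.
move=> ha hb; rewrite /quadruple ifF ?ifT; try lia.
by congr (omap _ (G _ _)); lia.
Qed.

Lemma quadruple_se x y u v : x = N + u -> y + v = N -> 0 < v ->
  quadruple N G x y = omap (addn (2 * N - 1)) (G v u.+1).
Proof.
move=> ha hb v0; rewrite /quadruple ifF ?ifF; try lia.
by congr (omap _ (G _ _)); lia.
Qed.

End Quadruple.

(** The side values are what the gluing of copies has to match. [birth_corner] compares column 1
    with row 1, which face each other across the seam between the rotated copy and the translate. In
    [birth_spread] all points beyond the block count as never born. *)
Record self_similar (N : nat) (G : nat -> nat -> option nat) : Prop := {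
  birth_out x y : (N <= x) || (N < y) -> G x y = None;
  birth00 : G 0 0 = Some 1;
  birth01 : G 0 1 = Some 2;
  birth_left y : 1 < y -> G 0 y = None;
  birth_bottom x : 0 < x -> G x 0 = None;
  birth_gt0 x y m : G x y = Some m -> 0 < m;
  birth_top x : 0 < x < N -> G x N = if odd x then Some (2 * N) else None;
  birth_right y : 0 < y < N ->
    G N.-1 y = if odd y then Some (2 * N).-1 else None;
  birth_corner u : odd u -> u < N -> G 1 u.+1 = omap succn (G u 1);
  birth_spread x y : 0 < x < N -> 0 < y <= N -> G x y = spread G x y
}.

(** The induction starts at side 2, since the gluing step needs an even side. *)
Lemma self_similar_block1 : self_similar 2 (block 1).
Proof.
have b1 x y : block 1 x y = match x, y with
  | 0, 0 => Some 1 | 0, 1 => Some 2 | 1, 1 => Some 3 | 1, 2 => Some 4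
  | _, _ => None end.
  by case: x => [|[|x]] //; case: y => [|[|[|y]]].
split; rewrite ?b1 //.
- by move=> [|[|x]] [|[|[|y]]]; rewrite b1.
- by move=> [|[|y]]; rewrite b1.
- by move=> [|[|x]]; rewrite b1.
- by move=> [|[|x]] [|[|[|y]]] m; rewrite b1 // => -[<-].
- by move=> [|[|x]]; rewrite b1.
- by move=> [|[|x]]; rewrite b1.
- by move=> [|[|u]]; rewrite !b1.
- by move=> [|[|x]] [|[|[|y]]] //; rewrite /spread !b1.
Qed.

(** Inside a copy the rule persists because [newborn] commutes with delays; the rotation flips the
    parity of the coordinate sum, as it exchanges the two orientations. Only points at a seam need
    the side values. The nine cases compare [x] and [y] with [N]. *)
Lemma self_similar_quadruple N G : 0 < N -> ~~ odd N ->
  self_similar N G -> self_similar (2 * N) (quadruple N G).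
Proof.
move=> N0 Nev [out b00 b01 left bot pos top right corner rule].
have outD x y : (2 * N <= x) || (2 * N < y) -> quadruple N G x y = None.
  move=> h; rewrite /quadruple; repeat case: ifP => ?; rewrite out //; lia.
have botD x : 0 < x -> quadruple N G x 0 = None.
  move=> x0; rewrite /quadruple.
  by repeat case: ifP => ?; rewrite ?bot ?out //; lia.
have leftD y : 1 < y -> quadruple N G 0 y = None.
  move=> y1; rewrite /quadruple.
  by repeat case: ifP => ?; rewrite ?left ?out //; lia.
have posD x y m : quadruple N G x y = Some m -> 0 < m.
  rewrite /quadruple; repeat case: ifP => ?; try (by apply: pos);
  by case E: (G _ _) => [m'|] //= [<-]; have := pos _ _ _ E; lia.
split=> //.
- by rewrite quadruple_old.
- by rewrite quadruple_old.
- move=> x hx; case: (ltngtP x N) => xN.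
  + rewrite (@quadruple_nw _ _ _ _ (N - x) N); try lia.
    rewrite top ?oddB; try lia.
    by rewrite (negbTE Nev); case: (odd x) => //=; congr Some; lia.
  + rewrite (@quadruple_ne _ _ _ _ (x - N) N); try lia.
    rewrite top ?oddB; try lia.
    by rewrite (negbTE Nev) addbF; case: (odd x) => //=; congr Some; lia.
  + rewrite (@quadruple_ne _ _ _ _ 0 N); try lia.
    by rewrite left ?xN ?(negbTE Nev) //; lia.
- move=> y hy; case: (ltngtP y N) => yN.
  + rewrite (@quadruple_se _ _ _ _ N.-1 (N - y)); try lia.
    rewrite prednK // top ?oddB; try lia.
    by rewrite (negbTE Nev); case: (odd y) => //=; congr Some; lia.
  + rewrite (@quadruple_ne _ _ _ _ N.-1 (y - N)); try lia.
    rewrite right ?oddB; try lia.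
    by rewrite (negbTE Nev) addbF; case: (odd y) => //=; congr Some; lia.
  + rewrite (@quadruple_ne _ _ _ _ N.-1 0); try lia.
    by rewrite bot ?yN ?(negbTE Nev) //; lia.
- move=> u uo hu; case: (ltnP u N) => uN.
    by rewrite !quadruple_old ?corner //; lia.
  rewrite (@quadruple_nw _ _ _ _ N.-1 (u - N).+1); try lia.
  rewrite (@quadruple_se _ _ _ _ (u - N) N.-1); try lia.
  by case: (G _ _) => //= m; congr Some; lia.
- move=> x y hx hy; rewrite /spread.
case: (ltngtP x N) => xN; case: (ltngtP y N) => yN.
+ rewrite quadruple_old; try lia. rewrite rule; try lia. rewrite /spread.
  case: ifP => par; first by rewrite !quadruple_old //; lia.
  rewrite (@quadruple_old _ _ x.-1); try lia.
  case: (ltnP x.+1 N) => xN'; first by rewrite quadruple_old //; lia.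
  have xE : x = N.-1 by lia. subst x.
  have yo : odd y by lia.
  (* With column [N] empty, the rule forces the left parent to be born at [2 * N - 2]. The new right
     parent is born at [2 * N] at the earliest, if at all, so the birth time stays the same. *)
  have rl : Some (2 * N).-1 = omap succn (G N.-1.-1 y).
    have := rule N.-1 y; rewrite right /spread ?yo ?par; last by lia.
    rewrite prednK // (out N y) ?newbornN; last by lia.
    by apply; lia.
  rewrite (@quadruple_se _ _ _ _ 0 (N - y)); try lia.
  have -> : G N.-1.-1 y = Some (2 * N).-2.
    by case: (G _ _) rl => //= m [rl]; congr Some; lia.
  rewrite (out N.-1.+1) ?newbornN /=; last by lia.
  case E: (G _ 1) => [m|]; last by rewrite newbornN.
  have := pos _ _ _ E => m0.
  rewrite /newborn (inj_eq Some_inj) /= ifF; last by lia.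
  by congr Some; lia.
+ rewrite (@quadruple_nw _ _ _ _ (N - x) (y - N)); try lia.
  rewrite rule; try lia. rewrite /spread.
  have -> : odd (N - x + (y - N)) = odd (x + y) by lia.
  case: ifP => par; rewrite -newborn_shift.
    rewrite (@quadruple_nw _ _ x y.+1 (N - x) (y - N).+1); try lia.
    case: (ltnP N y.-1) => yN'.
      by rewrite (@quadruple_nw _ _ x y.-1 (N - x) (y - N).-1); try lia.
    (* Here [x] is even: the point of row [N] is never born, like the bottom row of the reflected
       copy. *)
    rewrite quadruple_old; try lia.
    have -> : (y - N).-1 = 0 by lia. have -> : y.-1 = N by lia.
    rewrite (bot (N - x)); try lia.
    by rewrite top ?ifF //; lia.
  rewrite newbornC; congr newborn.
    by rewrite (@quadruple_nw _ _ x.-1 y (N - x).+1 (y - N)); try lia.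
  case: (ltnP x.+1 N) => xN'.
    by rewrite (@quadruple_nw _ _ x.+1 y (N - x).-1 (y - N)); try lia.
  rewrite (@quadruple_ne _ _ x.+1 y 0 (y - N)); try lia.
  by congr (omap _ (G _ _)); lia.
+ (* [birth_top] holds: two consecutive odd points are born together at 2 N,
     so that the even point between them is never born *)
  subst y; rewrite quadruple_old; try lia.
  rewrite top; try lia.
  case: ifP => xo; last first.
    rewrite ifF; try lia. rewrite !quadruple_old; try lia.
    rewrite !top; try lia.
    have -> : odd x.-1 by lia. have -> : odd x.+1 by lia.
    by rewrite newborn_same.
  rewrite ifT; try lia.
  (* The old rule puts the lower parent at [2 * N - 1]; the new upper one is born after [2 * N], if
     at all. *)
  have rl : Some (2 * N) = omap succn (G x N.-1).
    have := rule x N; rewrite top /spread ?xo ?ifT; try lia.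
    rewrite (out x N.+1) ?newbornN; last by lia.
    by apply; lia.
  rewrite quadruple_old; try lia.
  rewrite (@quadruple_nw _ _ _ _ (N - x) 1); try lia.
  have -> : G x N.-1 = Some (2 * N).-1.
    by case: (G _ _) rl => //= m [rl]; congr Some; lia.
  case E: (G _ 1) => [m|]; last by rewrite newbornN /=; congr Some; lia.
  have := pos _ _ _ E => m0.
  rewrite /newborn (inj_eq Some_inj) /= ifF; last by lia.
  by congr Some; lia.
+ rewrite (@quadruple_se _ _ _ _ (x - N) (N - y)); try lia.
  rewrite rule; try lia. rewrite /spread.
  have -> : odd (N - y + (x - N).+1) = ~~ odd (x + y) by lia.
  rewrite if_neg; case: ifP => par; rewrite -newborn_shift /=.
    rewrite newbornC; congr newborn.
      by rewrite (@quadruple_se _ _ _ _ (x - N) (N - y).+1); try lia.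
    case: (ltnP y.+1 N) => yN'.
      by rewrite (@quadruple_se _ _ _ _ (x - N) (N - y).-1); try lia.
    rewrite (@quadruple_ne _ _ _ _ (x - N) 0); try lia.
    have -> : (N - y).-1 = 0 by lia.
    rewrite bot; last by lia.
    by rewrite left //; lia.
  congr newborn.
    by rewrite (@quadruple_se _ _ _ _ (x - N).-1 (N - y)) ?prednK; try lia.
  by rewrite (@quadruple_se _ _ _ _ (x - N).+1 (N - y)); try lia.
+ rewrite (@quadruple_ne _ _ _ _ (x - N) (y - N)); try lia.
  rewrite rule; try lia. rewrite /spread.
  have -> : odd (x - N + (y - N)) = odd (x + y) by lia.
  case: ifP => par; rewrite -newborn_shift; congr newborn; symmetry;
    apply: quadruple_ne; lia.
+ (* [birth_corner]: the parents above and below this line are born together *)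
  subst y. rewrite (@quadruple_ne _ _ _ _ (x - N) 0); try lia.
  rewrite bot; try lia.
  case: ifP => par.
    rewrite (@quadruple_se _ _ _ _ (x - N) 1); try lia.
    rewrite (@quadruple_ne _ _ _ _ (x - N) 1); try lia.
    rewrite corner; try lia.
    case: (G _ 1) => [m|] //=; rewrite /newborn /= ifT //.
    by apply/eqP; congr Some; lia.
  rewrite (@quadruple_ne _ _ _ _ (x - N).-1 0); try lia.
  rewrite (@quadruple_ne _ _ _ _ (x - N).+1 0); try lia.
  by rewrite !bot //; lia.
+ (* [birth_right]: the even points of the last column are never born, which
     isolates the rotated copy from the old square *)
  subst x; rewrite (@quadruple_se _ _ _ _ 0 (N - y)); try lia.
  rewrite rule; try lia. rewrite /spread.
  have -> : odd (N - y + 1) = ~~ odd (N + y) by lia.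
  rewrite if_neg; case: ifP => par; rewrite -newborn_shift /=.
    rewrite newbornC; congr newborn.
      by rewrite (@quadruple_se _ _ _ _ 0 (N - y).+1); try lia.
    case: (ltnP y.+1 N) => yN'.
      by rewrite (@quadruple_se _ _ _ _ 0 (N - y).-1); try lia.
    rewrite (@quadruple_ne _ _ _ _ 0 0); try lia.
    have -> : (N - y).-1 = 0 by lia.
    by rewrite b00 b01 /=; congr Some; lia.
  congr newborn.
    rewrite bot ?quadruple_old ?right ?ifF //; lia.
  by rewrite (@quadruple_se _ _ _ _ 1 (N - y)); try lia.
+ (* by reflection the parents left and right of this line are born together *)
  subst x; rewrite (@quadruple_ne _ _ _ _ 0 (y - N)); try lia.
  case: ifP => par.
    rewrite (@quadruple_ne _ _ _ _ 0 (y - N).-1); try lia.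
    rewrite (@quadruple_ne _ _ _ _ 0 (y - N).+1); try lia.
    case: (ltnP 1 (y - N)) => yN'.
      by rewrite !left //; lia.
    have -> : y - N = 1 by lia. rewrite b00 b01 left //= /newborn /=.
    by congr Some; lia.
  rewrite (@quadruple_nw _ _ _ _ 1 (y - N)); try lia.
  rewrite (@quadruple_ne _ _ _ _ 1 (y - N)); try lia.
  by rewrite newborn_same left //; lia.
(* The root of the translate is born at [2 * N + 1] from its left parent alone, which [birth_top]
   places at [2 * N]. *)
+ subst x y; rewrite ifF; last by lia.
  rewrite (@quadruple_ne _ _ N N 0 0) ?(@quadruple_ne _ _ N.+1 N 1 0); try lia.
  rewrite quadruple_old ?top ?b00 ?bot; try lia.
  have -> : odd N.-1 by lia.
  by rewrite newbornN /=; congr Some; lia.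
Qed.

Lemma self_similar_block k : 0 < k -> self_similar (2 ^ k) (block k).
Proof.
elim: k => // -[_ _|k IH _]; first exact: self_similar_block1.
rewrite [2 ^ _]expnS; apply: self_similar_quadruple; last exact: IH.
  by rewrite expn_gt0.
by rewrite expnS oddM.
Qed.

(** * Stabilisation of the blocks and birth times on the whole quadrant *)

Lemma block_out k x y : (2 ^ k <= x) || (2 ^ k < y) -> block k x y = None.
Proof.
case: k => [|k]; last by apply: birth_out; apply: self_similar_block.
by case: x => [|x]; case: y => [|[|y]].
Qed.

(** Copies made at a scale [j >= k] are delayed by at least [2 * 2 ^ j - 1 >= 2 ^ k] stages. Hence
    the births before [2 ^ k] lie in a bounded region. *)
Lemma block_late k j x y m : (2 ^ k <= x) || (2 ^ k < y) ->
  block j x y = Some m -> 2 ^ k <= m.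
Proof.
move=> far; elim: j => [|j IH]; last move=> /=.
  rewrite block_out //; have := expn_gt0 2 k; lia.
case: (ltnP j k) => jk.
  have : 2 ^ j.+1 <= 2 ^ k by rewrite leq_exp2l.
  by move=> h; rewrite -[quadruple _ _ _ _]/(block j.+1 x y) block_out //; lia.
have : 2 ^ k <= 2 ^ j by rewrite leq_exp2l.
have := expn_gt0 2 k => k0 kj.
rewrite /quadruple; repeat case: ifP => ?; first exact: IH;
  by case: (block _ _ _) => //= i [<-]; lia.
Qed.

(** The scale [x + y] is large enough because [x + y < 2 ^ (x + y)]; larger scales agree with it by
    [block_stable]. *)
Definition birth (x y : nat) : option nat := block (x + y) x y.

Lemma block_stable k j x y : x < 2 ^ k -> y <= 2 ^ k -> k <= j ->
  block j x y = block k x y.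
Proof.
move=> xk yk; elim: j => [|j IH]; first by rewrite leqn0 => /eqP->.
rewrite leq_eqVlt => /orP[/eqP<-//|]; rewrite ltnS => kj.
have : 2 ^ k <= 2 ^ j by rewrite leq_exp2l.
by move=> h; rewrite /= quadruple_old ?IH //; lia.
Qed.

Lemma birthE k x y : x < 2 ^ k -> y <= 2 ^ k -> birth x y = block k x y.
Proof.
move=> xk yk; have xy := ltn_expl (x + y) (ltnSn 1).
rewrite /birth -(@block_stable _ (maxn k (x + y)) x y _ _ (leq_maxl _ _)) //.
by rewrite -(@block_stable (x + y) (maxn k (x + y))) ?leq_maxr //; lia.
Qed.

Lemma birth_in_block k x y m : birth x y = Some m -> m < 2 ^ k ->
  (x < 2 ^ k) && (y <= 2 ^ k).
Proof.
move=> bm mk; apply: contraTT mk => far; rewrite -ltnNge.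
by apply: block_late bm; lia.
Qed.

Lemma birth_block_eq k x y m : m < 2 ^ k ->
  (birth x y == Some m) = (block k x y == Some m).
Proof.
move=> mk; case: (boolP ((x < 2 ^ k) && (y <= 2 ^ k))) => [/andP[xk yk]|far].
  by rewrite (birthE xk yk).
rewrite block_out; last by lia.
by apply/eqP => /birth_in_block/(_ mk); rewrite (negbTE far).
Qed.

Lemma exists_block x y : exists2 k, 0 < k & (x.+1 < 2 ^ k) && (y.+1 <= 2 ^ k).
Proof.
by exists (x + y).+2 => //; have := ltn_expl (x + y).+2 (ltnSn 1); lia.
Qed.

Lemma birth_axis x y : x * y = 0 ->
  birth x y = if (x, y) == (0, 0) then Some 1
              else if (x, y) == (0, 1) then Some 2 else None.
Proof.
have [k k0 /andP[xk yk]] := exists_block x y.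
rewrite (@birthE k); try lia. have S := self_similar_block k0.
case: x xk => [|x] xk.
  case: y yk => [|[|y]] yk _; rewrite ?(birth00 S) ?(birth01 S) //.
  by rewrite (birth_left S).
by case: y yk => // yk _; rewrite (birth_bottom S).
Qed.

Lemma birth_row0 x : 0 < x -> birth x 0 = None.
Proof. by case: x => // x _; rewrite birth_axis ?muln0. Qed.

Lemma birth_interior x y : 0 < x -> 0 < y -> birth x y = spread birth x y.
Proof.
move=> x0 y0; have [k k0 /andP[xk yk]] := exists_block x y.
rewrite /spread !(@birthE k); try lia.
by rewrite (birth_spread (self_similar_block k0)) //; lia.
Qed.

Lemma birth_diagonal u : odd u -> birth 1 u.+1 = omap succn (birth u 1).
Proof.
move=> uo; have [k k0 /andP[xk yk]] := exists_block u.+1 u.+1.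
rewrite !(@birthE k); try lia.
by rewrite (birth_corner (self_similar_block k0)) //; lia.
Qed.

Lemma birth_positive x y m : birth x y = Some m -> 0 < m.
Proof.
have [k k0 /andP[xk yk]] := exists_block x y.
by rewrite (@birthE k); try lia; apply: birth_gt0 (self_similar_block k0) _ _ _.
Qed.

(** * Birth times of the two structures on the lattice Z^2 *)

Local Open Scope ring_scope.

Definition lying (p : int * int) : bool := odd (`|p.1| + `|p.2|)%N.

Definition parent (s : bool) (p : int * int) : int * int :=
  if lying p then (p.1, p.2 + (-1) ^+ s) else (p.1 + (-1) ^+ s, p.2).

Definition toothpick_birth (p : int * int) : option nat := birth `|p.1| `|p.2|.

(* For the corner structure the lattice is centred at (1/2, 0), the free end of
   the initial half-toothpick. *)
Definition corner_birth (p : int * int) : option nat :=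
  match p with
  | (x, Posz v) => birth `|x| v
  | (Posz u, Negz v) => omap predn (birth v.+1 u.+1)
  | (Negz _, Negz _) => None
  end.

Definition spreads (t : int * int -> option nat) (p : int * int) : Prop :=
  t p = newborn (t (parent false p)) (t (parent true p)).

(** On the axis [x = 0] the two horizontal parents are mirror images, hence born together. *)
Lemma birth_mirror (x : int) (y : nat) : (x, Posz y) != (0, 0) -> (0 < y)%N ->
  birth `|x| y =
    if odd (`|x| + y)%N then newborn (birth `|x| y.-1) (birth `|x| y.+1)
    else newborn (birth `|x - 1| y) (birth `|x + 1| y).
Proof.
move=> xy y0; case: x xy => [[|x]|x] xy.
- have -> : absz (0%:Z + 1) = 1%N by []. have -> : absz (0%:Z - 1) = 1%N by [].
  rewrite newborn_same absz0 add0n !birth_axis ?mul0n // !xpair_eqE.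
  by case: y y0 {xy} => [|[|[|y]]] //= _; rewrite if_same.
- have -> : absz (x.+1%:Z - 1) = x by lia.
  have -> : absz (x.+1%:Z + 1) = x.+2 by lia.
  exact: birth_interior.
- have -> : absz (Negz x - 1) = x.+2 by lia.
  have -> : absz (Negz x + 1) = x by lia.
  by rewrite [newborn (birth x.+2 y) _]newbornC; apply: birth_interior.
Qed.

Lemma toothpick_birth_spreads p : p != (0, 0) -> spreads toothpick_birth p.
Proof.
case: p => x y xy; rewrite /spreads /parent /toothpick_birth /lying /=.
rewrite expr0 expr1.
case: y xy => [[|y]|y] xy.
(* On row 0 the vertical parents of an odd point are mirror images, and the horizontal parents of a
   nonzero even point are odd points of the row, never born. *)
- have x0 : (0 < `|x|)%N by rewrite absz_gt0; move: xy; rewrite xpair_eqE andbT.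
  rewrite addn0 birth_row0 //; case: ifP => xo /=.
    by rewrite newborn_same.
  have -> : birth `|x + 1| 0 = None by apply: birth_row0; lia.
  by rewrite birth_row0 //; lia.
- rewrite (@birth_mirror x y.+1) //=; case: ifP => _ /=.
    by rewrite newbornC; congr newborn; congr birth; lia.
  by rewrite newbornC.
- rewrite (@birth_mirror x y.+1) //=.
  case: ifP => _ /=.
    by congr newborn; congr birth; lia.
  by rewrite newbornC.
Qed.

(** The three quadrants fit together like the three copies around [(N, N)] in [quadruple], with the
    common delay [2 * N] removed. Along the positive x-axis the vertical parents are born together
    by [birth_diagonal]. *)
Lemma corner_birth_spreads p : p != (0, 0) -> (0 < p.2) || (0 <= p.1) ->
  spreads corner_birth p.
Proof.
case: p => x y /= xy ok; rewrite /spreads /parent /lying /=.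
rewrite expr0 expr1.
case: y xy ok => [[|y]|y] xy ok.
- case: x xy ok => [[|x]|x] // xy _.
  rewrite {1}/corner_birth birth_row0 // addn0; case: ifP => xo /=.
    rewrite birth_diagonal //; case E: (birth _ 1) => [m|] //=.
    by rewrite /newborn ifT //; apply/eqP; congr Some; lia.
  have -> : birth `|x.+1%:Z + 1| 0 = None by apply: birth_row0; lia.
  by rewrite birth_row0 //; lia.
- have -> : y.+1%:Z + 1 = y.+2 by lia. have -> : y.+1%:Z - 1 = y by lia.
  rewrite /= (@birth_mirror x y.+1) //; case: ifP => _ /=; rewrite newbornC.
    by case: x {xy ok}.
  by case: (x + 1) (x - 1) => a [] b; case: (x).
- case: x xy ok => [x|x] // xy _; rewrite {1}/corner_birth.
rewrite birth_interior // /spread.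
have -> : odd (y.+1 + x.+1) = ~~ odd (x + y.+1) by lia.
rewrite if_neg; case: ifP => par.
  have -> : (Negz y - 1) = Negz y.+1 by lia.
  rewrite newbornC -newborn_pred; try exact: birth_positive.
  case: y xy par => [|y] xy par.
    (* At height -1 the upper parent lies on row 0: the root, born at 1, stands in for the point of
       the rotated quadrant born at 2. *)
    have -> : Negz 0 + 1 = 0 by [].
    rewrite newbornC. congr newborn; rewrite !birth_axis ?muln0 //.
    by case: x xy par => [|[|x]].
  have -> : Negz y.+1 + 1 = Negz y by lia.
  by rewrite newbornC.
have -> : (x : int) + 1 = x.+1 by lia.
rewrite newbornC -newborn_pred; try exact: birth_positive.
congr newborn; case: x xy par => [|x] xy par.
  by rewrite birth_row0.
by have -> : (x.+1 : int) - 1 = x by lia.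
Qed.

(** * From lattice birth times to segments *)

Definition born_by (o : option nat) (n : nat) : bool :=
  if o is Some m then (m <= n)%N else false.

(** With [born_newborn] this is the link to exposure: a point joins at stage [n.+1] when exactly one
    parent is present at stage [n]. *)
Lemma newborn_by a b n :
  born_by (newborn a b) n.+1 ->
  born_by (newborn a b) n \/ (born_by a n /\ ~~ born_by b n)
                          \/ (born_by b n /\ ~~ born_by a n).
Proof.
case: a b => [i|] [j|]; rewrite /newborn //= ?(inj_eq Some_inj).
- by case: eqP => //= ij h; rewrite /born_by; lia.
- by move=> h; right; left.
- by move=> h; right; right.
Qed.

Lemma born_newborn a b n : born_by a n -> ~~ born_by b n ->
  born_by (newborn a b) n.+1.
Proof.
case: a b => [i|] [j|]; rewrite /newborn //= ?(inj_eq Some_inj).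
by case: eqP => //= ij; lia.
Qed.

Section Lattice.
Variables (R : realType) (c : R).
Implicit Types p q : int * int.

(* The offset [c] is 0 for the toothpick structure and 1 for the corner
   structure. *)
Definition pos p : point R := ((p.1%:~R + c) / 2, p.2%:~R / 2).
Definition site p : segment R := toothpick (pos p) (lying p).

Lemma pos_inj : injective pos.
Proof.
move=> [x y] [x' y'] [/= ex ey]; congr pair; apply: (@intr_inj R); lra.
Qed.

Lemma site_inj : injective site.
Proof. by move=> p q /(congr1 (@midpoint R)) /pos_inj. Qed.

Lemma lying_parent s p : lying (parent s p) = ~~ lying p.
Proof.
rewrite /parent; case: ifP; case: s p => [] [x y];
  rewrite /lying /= ?expr0 ?expr1; lia.
Qed.

Lemma ends_siteE q : ends (site q) =
  let e (d : int) := pos (if lying q then (q.1 + d, q.2) else (q.1, q.2 + d)) in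
  [fset e (-1)%R; e 1%R]%fset.
Proof.
case: q => x y; rewrite /ends /shift /site /pos /halflength /=.
by case: (lying _) => /=; congr [fset _; _]%fset; congr pair;
  rewrite ?rmorphD ?rmorphB /=; lra.
Qed.

(** Adjacent sites have opposite orientations, so only the two neighbours in the direction
    perpendicular to [p] have an end there. *)
Lemma mem_ends_site p q : pos p \in ends (site q) =
  (q == parent false p) || (q == parent true p).
Proof.
rewrite ends_siteE in_fset2 !(inj_eq pos_inj).
case: p q => [x y] [x' y']; rewrite /parent /lying /= expr0 expr1.
by do 2 case: ifP => ?; rewrite !xpair_eqE /=; lia.
Qed.

Lemma ends_site_pos q e : e \in ends (site q) -> exists p, e = pos p.
Proof.
by rewrite ends_siteE in_fset2 => /orP[] /eqP ->; eexists.
Qed.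

End Lattice.

Section Growth.
Variables (R : realType) (c : R) (H : {fset segment R}).
Variables (allowed : segment R -> Prop) (t : int * int -> option nat).
Local Notation pos := (pos c).
Local Notation site := (site c).

(** [H] collects the segments that are not lattice sites: none for the toothpick structure, the
    initial half-toothpick for the corner structure. *)
Definition represents (S : {fset segment R}) (n : nat) : Prop :=
  forall s, s \in S <-> s \in H \/ exists2 p, born_by (t p) n & s = site p.

Hypothesis t0 : t (0, 0) = Some 1%N.
Hypothesis tP : forall p, p != (0, 0) -> allowed (site p) -> spreads t p.
Hypothesis tN : forall p, ~ allowed (site p) -> t p = None.
Hypothesis H_site : forall p, site p \notin H.
Hypothesis H_ends : forall h e, h \in H -> e \in ends h ->
  e = pos (0, 0) \/ ~ allowed (toothpick e (~~ horizontal h)).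
Hypothesis H_free : forall h p, h \in H -> allowed (site p) -> p != (0, 0) ->
  pos p \notin ends h /\ pos p != midpoint h.

Lemma additionsP S s : reflect
  (exists s0 e, [/\ s0 \in S, e \in ends s0, exposed S s0 e,
     allowed (toothpick e (~~ horizontal s0)) &
     s = toothpick e (~~ horizontal s0)])
  (s \in additions allowed S).
Proof.
apply: (iffP (imfset2P _ _ _ _ _)) => /=.
- move=> [s0 Ss0 [e]]; rewrite inE => /andP[es0 /asboolP[ex al]] ->.
  by exists s0, e.
- move=> [s0 [e [Ss0 es0 ex al ->]]]; exists s0 => //; exists e => //.
  by rewrite inE; apply/andP; split=> //; apply/asboolP.
Qed.

(** The end [pos p] of a parent of [p] is exposed when neither the other parent nor [p] itself is
    present, which is when the birth rule adds [p] next. *)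
Lemma grow_represents S n : (0 < n)%N ->
  represents S n -> represents (grow allowed S) n.+1.
Proof.
move=> n0 rep s; have S0 : site (0, 0) \in S.
  by apply/rep; right; exists (0, 0); rewrite ?t0.
rewrite /grow in_fsetU; split.
- case/orP => [/rep[|[p tp ->]]|]; [by left| |].
    right; exists p => //; move: tp; rewrite /born_by.
    by case: (t p) => // m; lia.
  case/additionsP=> s0 [e [Ss0 es0 [_ ex] al ->]].
  case: (rep s0).1 => // [Hs0|[q tq s0E]].
    (* An end of [H] at [pos (0, 0)] is the midpoint of the seed, present since [n] is positive, so
       it is not exposed. *)
    case: (H_ends Hs0 es0) => // e0.
    have ne : site (0, 0) != s0.
      by apply/eqP => E; have := H_site (0, 0); rewrite E Hs0.
    by have [_ /eqP] := ex _ S0 ne; rewrite e0.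
  subst s0; have [p eE] := ends_site_pos es0; subst e.
  right; exists p; last first.
    have : q = parent false p \/ q = parent true p.
      by move: es0; rewrite mem_ends_site => /orP[] /eqP; [left|right].
    by case=> ->; rewrite /site /toothpick /= lying_parent negbK.
  case: (eqVneq p (0, 0)) => [->|p0]; first by rewrite t0.
  have alp : allowed (site p).
    move: es0 al; rewrite mem_ends_site.
    by case/orP => /eqP ->; rewrite /site /toothpick /= lying_parent negbK.
  rewrite tP //.
  (* A second parent already present would share the end [pos p]. *)
  have other q' : q' != q -> (q' == parent false p) || (q' == parent true p) ->
      ~~ born_by (t q') n.
    move=> q'q par; apply/negP => tq'.
    have Sq' : site q' \in S by apply/rep; right; exists q'.
    have [] := ex _ Sq'; first by rewrite (inj_eq (@site_inj _ _)).
    by rewrite mem_ends_site par.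
  have par2 : parent false p != parent true p.
    rewrite /parent; case: ifP => _; case: (p) => x y;
      rewrite xpair_eqE expr0 expr1 /=; lia.
  move: es0; rewrite mem_ends_site => /orP[] /eqP qE; subst q.
    by apply: born_newborn => //; apply: other; rewrite ?eqxx ?orbT // eq_sym.
  rewrite newbornC; apply: born_newborn => //.
  by apply: other; rewrite ?eqxx ?orbT.
- case=> [Hs|[p tp ->]]; first by apply/orP; left; apply/rep; left.
  case: (boolP (born_by (t p) n)) => tpn.
    by apply/orP; left; apply/rep; right; exists p.
  case: (eqVneq p (0, 0)) => [p0|p0].
    by move: tpn; rewrite p0 t0 /= n0.
  have alp : allowed (site p).
    by case: (pselect (allowed (site p))) => // /tN pN; rewrite pN in tp.
  apply/orP; right; apply/additionsP.
  have [b [tq tq']] : exists b,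
      born_by (t (parent b p)) n /\ ~~ born_by (t (parent (~~ b) p)) n.
    move: tp tpn; rewrite tP // => /newborn_by[->|[[h1 h2]|[h1 h2]]] // _.
      by exists false.
    by exists true.
  have mem : pos p \in ends (site (parent b p)).
    by rewrite mem_ends_site; case: (b); rewrite eqxx ?orbT.
  exists (site (parent b p)), (pos p); split=> //.
  + by apply/rep; right; exists (parent b p).
  + split=> // s' /rep[Hs'|[q hq ->]] ne; first exact: H_free.
    rewrite mem_ends_site; split.
      apply/negP => /orP[] /eqP qE; case: (b) tq tq' ne; rewrite qE in hq *;
        by rewrite ?hq ?eqxx.
    rewrite (inj_eq (@pos_inj _ _)); apply/eqP => qE.
    by rewrite -qE (negbTE tpn) in hq.
  + by rewrite /horizontal /= lying_parent negbK.
  + by rewrite /horizontal /= lying_parent negbK.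
Qed.

End Growth.

Lemma toothpick_birth_gt0 p m : toothpick_birth p = Some m -> (0 < m)%N.
Proof. exact: birth_positive. Qed.

Lemma corner_birth_gt0 p m : corner_birth p = Some m -> (0 < m)%N.
Proof.
case: p => [[u|u] [v|v]] //; try exact: birth_positive.
rewrite /corner_birth birth_interior // /spread /newborn.
by case: ifP => _; case: eqP => // _;
  case E: (birth _ _) => [i|]; case F: (birth _ _) => [j|] //= [<-];
  try have := birth_positive E; try have := birth_positive F; lia.
Qed.

Lemma first_born t : (forall p m, t p = Some m -> (0 < m)%N) ->
  (forall p, p != (0, 0) -> spreads t p \/ t p = None) ->
  forall p, born_by (t p) 1 -> p = (0, 0).
Proof.
move=> t_gt0 tP p; case: (eqVneq p (0, 0)) => // /tP[->|->] //.
rewrite /newborn; case: eqP => //= _.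
case E: (t _) => [i|]; case F: (t _) => [j|] //=;
  try have := t_gt0 _ _ E; try have := t_gt0 _ _ F; lia.
Qed.

(** * Both structures follow their lattice birth times *)

Section Structures.
Variable R : realType.

Lemma toothpick_represents n :
  represents 0 fset0 toothpick_birth (toothpick_structure R n) n.
Proof.
case: n => [|n].
  move=> s; rewrite /toothpick_structure in_fset0; split=> // -[//|[p tp _]].
  move: tp; case E: (toothpick_birth p) => [m|] //=.
  by have := toothpick_birth_gt0 E; lia.
elim: n => [|n IH].
  move=> s; rewrite /toothpick_structure /= in_fset1.
  have -> : toothpick (0, 0) false = site (0 : R) (0, 0).
    by rewrite /site /pos /= !addr0 !mul0r.
  split=> [/eqP ->|[//|[p tp ->]]]; first by right; exists (0, 0).
  rewrite (first_born toothpick_birth_gt0 _ tp) // => q.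
  by move=> /toothpick_birth_spreads; left.
rewrite /toothpick_structure iterS -/(toothpick_structure R n.+1).
apply: grow_represents => // p p0 _; exact: toothpick_birth_spreads.
Qed.

Lemma shift_interior (s : segment R) u :
  `|u| < halflength s -> shift s u \notin ends s.
Proof.
case/ltr_normlP => u1 u2; rewrite in_fset2 /shift; case: (midpoint s) => a b.
case: (horizontal s); rewrite !xpair_eqE !(inj_eq (addrI _)) !eqxx ?andbT /=;
  by apply/norP; split; apply/eqP => e; lra.
Qed.

(** Apart from [(-1, 0)], every forbidden site has its centre in the third quadrant or on a negative
    half-axis. The other sites reach these half-axes with an end at most. *)
Lemma corner_allowedP p :
  corner_allowed (site (1 : R) p) <-> (0 < p.2) || (0 <= p.1).
Proof.
have half0 : (0 : R) < 1 / 2 by lra.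
case: p => x y /=; split.
- move=> al; apply: contraT; rewrite negb_or -leNgt -ltNge => /andP[y0 x0].
  have inner u p : `|u| < 1 / 2 -> p = shift (site (1 : R) (x, y)) u ->
      ~ (p.1 < 0 /\ p.2 < 0) /\
      ~ (p.1 < 0 /\ p.2 = 0 \/ p.1 = 0 /\ p.2 < 0).
    move=> uh ->; have [] := al (shift (site (1 : R) (x, y)) u).
      by exists u => //; apply: ltW.
    by move=> nq axis; split=> // /axis; apply/negP/shift_interior.
  (* This site is horizontal and centred at the origin, which is harmless itself; the violation
     occurs at [(-1/4, 0)]. *)
  case: (eqVneq (x, y) (-1, 0)) => [[xE yE]|xy].
    subst x y; have [] := inner (- (1 / 4)) _ _ erefl.
      by rewrite normrN ger0_norm; lra.
    rewrite /shift /site /pos /= => _ []; left; split; lra.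
  have [] := inner 0 _ _ erefl; first by rewrite normr0.
  rewrite /shift /site /pos /= => nq nax; exfalso.
  have X0 : (x%:~R + 1) / 2 <= 0 :> R.
    rewrite -[1]/(1%:~R) -rmorphD /=.
    have : (x + 1)%:~R <= 0 :> R by rewrite lerz0; lia.
    by lra.
  have Y0 : y%:~R / 2 <= 0 :> R.
    have : y%:~R <= 0 :> R by rewrite lerz0.
    by lra.
  move: X0 Y0; rewrite !le_eqVlt => /orP[/eqP X0|X0] /orP[/eqP Y0|Y0].
  + move/eqP: xy; apply; congr pair.
      apply: (@intr_inj R); rewrite rmorphN /=; lra.
    by apply: (@intr_inj R); rewrite /=; lra.
  + by apply: nax; right; case: (lying _); rewrite /= addr0.
  + by apply: nax; left; case: (lying _); rewrite /= addr0.
  + by apply: nq; case: (lying _); rewrite /= addr0.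
- move=> xy p [u]; rewrite /halflength /= => /ler_normlP[u1 u2] ->.
  have xy' : (1 <= y%:~R :> R) \/ (0 <= x%:~R :> R).
    by case/orP: xy => h; [left|right]; rewrite ?ler1z ?ler0z //; lia.
  rewrite in_fset2 /shift /site /pos /halflength /=.
  case: (lying _) => /=; rewrite !xpair_eqE ?eqxx ?andbT /=.
  + split; first by move=> []; case: xy' => *; lra.
    move=> [[a b]|[a b]]; first by exfalso; case: xy' => *; lra.
    apply/orP; left; apply/eqP; case: xy' => *; lra.
  + split; first by move=> []; case: xy' => *; lra.
    move=> [[a b]|[a b]]; last by exfalso; case: xy' => *; lra.
    apply/orP; left; apply/eqP; case: xy' => *; lra.
Qed.

Definition half_toothpick : segment R := ((1 / 4, 0), true, 1 / 4).

Lemma ends_half_toothpick e : (e \in ends half_toothpick) =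
  (e == pos (1 : R) (-1, 0)) || (e == pos 1 (0, 0)).
Proof.
rewrite in_fset2 /shift /half_toothpick /pos /halflength /=.
by congr ((e == _) || (e == _)); congr pair; rewrite ?rmorphN /=; lra.
Qed.

Lemma corner_represents n :
  represents 1 [fset half_toothpick]%fset corner_birth (corner_structure R n) n.
Proof.
have site_half p : site 1 p \notin [fset half_toothpick]%fset.
  rewrite in_fset1; apply/eqP => /(congr1 (@halflength R)).
  by rewrite /halflength /=; lra.
have ends_half h e : h \in [fset half_toothpick]%fset -> e \in ends h ->
    e = pos 1 (0, 0) \/ ~ corner_allowed (toothpick e (~~ horizontal h)).
  rewrite in_fset1 => /eqP ->; rewrite ends_half_toothpick.
  case/orP => /eqP ->; [right|by left].
  (* The vertical toothpick centred at the origin has [(0, -1/4)] as an inner point on the negative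
     y-axis. *)
  set s := toothpick _ _ => al; have hu : `|- (1 / 4)| < halflength s.
    by rewrite normrN ger0_norm /s /halflength /=; lra.
  have [] := al (shift s (- (1 / 4))).
    by exists (- (1 / 4)) => //; apply: ltW.
  move=> _ /(_ _)/negP; rewrite (negbTE (shift_interior hu)); case=> //.
  by right; rewrite /shift /s /pos /= rmorphN /=; split; lra.
have half_free h p : h \in [fset half_toothpick]%fset ->
    corner_allowed (site (1 : R) p) -> p != (0, 0) ->
    pos 1 p \notin ends h /\ pos 1 p != midpoint h.
  rewrite in_fset1 => /eqP -> /corner_allowedP al p0.
  rewrite ends_half_toothpick !(inj_eq (@pos_inj _ _)) negb_or p0 andbT.
  split; first by apply: contraTN al => /eqP ->.
  (* A site centred at [(1/4, 0)] would make an odd integer zero. *)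
  apply/eqP => -[e _].
  have : (p.1 * 2 + 1)%:~R = 0 :> R by rewrite rmorphD rmorphM /=; lra.
  by move/eqP; rewrite intr_eq0; lia.
have t_spreads p : p != (0, 0) -> corner_allowed (site (1 : R) p) ->
    spreads corner_birth p.
  by move=> p0 /corner_allowedP; apply: corner_birth_spreads.
have t_none p : ~ corner_allowed (site (1 : R) p) -> corner_birth p = None.
  move/corner_allowedP/negP; case: p => [[x|x] [[|y]|y]] //= _.
  by rewrite /corner_birth birth_row0.
elim: n => [|[|n] IH].
- move=> s; rewrite /corner_structure /=; split; first by left.
  case=> // -[p]; case E: (corner_birth p) => [m|] //=.
  by have := corner_birth_gt0 E; lia.
(* Stage 1 is done by hand, as [grow_represents] applies only once the seed is there. *)
- have first_site p : born_by (corner_birth p) 1 -> p = (0, 0).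
    apply: first_born corner_birth_gt0 _ _ => q q0.
    case: (pselect (corner_allowed (site (1 : R) q))) => [al|/t_none].
      by left; apply: t_spreads.
    by right.
  move=> s; rewrite /corner_structure /= /grow in_fsetU; split.
    case/orP; first by left.
    case/additionsP=> h [e [hH eh _ al ->]].
    case: (ends_half _ _ hH eh) => [->|//]; right; exists (0, 0) => //.
    by move: hH; rewrite in_fset1 => /eqP ->.
  case=> [->//|[p /first_site -> ->]]; apply/orP; right.
  apply/additionsP; exists half_toothpick, (pos 1 (0, 0)); split=> //.
  + by rewrite in_fset1.
  + by rewrite ends_half_toothpick eqxx orbT.
  + split; first by rewrite ends_half_toothpick eqxx orbT.
    by move=> s'; rewrite in_fset1 => /eqP -> /eqP.
  + exact/corner_allowedP.
- rewrite /corner_structure iterS; apply: grow_represents IH => //.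
Qed.

End Structures.

(** * Counting births *)

Section Counting.
Variable R : realType.

Lemma card_newborn (c : R) H t S S' n (L : seq (int * int)) :
  uniq L -> (forall p, t p = Some n.+1 -> p \in L) ->
  (forall p, site c p \notin H) ->
  represents c H t S n.+1 -> represents c H t S' n ->
  #|` (S `\` S')%fset | = (\sum_(p <- L) (t p == Some n.+1))%N.
Proof.
move=> uL Lt H_site rep rep'.
have -> : (S `\` S')%fset =
    [fset s in [seq site c p | p <- L & t p == Some n.+1]]%fset.
{ apply/fsetP => s; rewrite in_fsetD [in RHS]inE /=; apply/andP/mapP.
  - move=> [/negP sS' /rep[Hs|[p tp sE]]]; first by case: sS'; apply/rep'; left.
    exists p => //; rewrite mem_filter.
    have tpn : t p = Some n.+1.
      have : ~~ born_by (t p) n.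
        by apply/negP => h; apply: sS'; apply/rep'; right; exists p.
      by case: (t p) tp => //= m h1 h2; congr Some; lia.
    by rewrite tpn eqxx; apply: Lt.
  - move=> [p]; rewrite mem_filter => /andP[/eqP tp _] ->; split; last first.
      by apply/rep; right; exists p; rewrite // tp /=.
    apply/negP => /rep'[Hp|[q tq /site_inj qE]].
      by have := H_site p; rewrite Hp.
    by move: tq; rewrite -qE tp /=; lia. }
rewrite card_fseq undup_id; last first.
  by rewrite map_inj_uniq ?filter_uniq //; apply: site_inj.
rewrite size_map size_filter -sum1_count big_mkcond.
by apply: eq_bigr => p _; case: eqP.
Qed.

Definition ints (M : nat) : seq int :=
  [seq Posz i | i <- iota 0 M.+1] ++ [seq Negz i | i <- iota 0 M].

Lemma mem_ints M x : (x \in ints M) = (`|x| <= M)%N.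
Proof.
rewrite mem_cat; apply/orP/idP.
  by case=> /mapP[i]; rewrite mem_iota => ? ->; lia.
case: x => i h; [left|right]; apply: map_f; rewrite mem_iota; lia.
Qed.

Lemma uniq_ints M : uniq (ints M).
Proof.
rewrite cat_uniq !map_inj_uniq ?iota_uniq ?andbT /=; try by move=> i j [].
by apply/hasPn => x /mapP[i _ ->]; apply/negP => /mapP[].
Qed.

Lemma sum_ints M (F : int -> nat) : (\sum_(x <- ints M) F x =
  F 0%R + \sum_(0 <= i < M) F i.+1 + \sum_(0 <= i < M) F (Negz i))%N.
Proof.
have iotaE K : iota 0 K = index_iota 0 K by rewrite /index_iota subn0.
by rewrite big_cat !big_map !iotaE big_nat_recl.
Qed.

Definition grid (M : nat) : seq (int * int) :=
  [seq (x, y) | x <- ints M, y <- ints M].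

Lemma uniq_grid M : uniq (grid M).
Proof. by rewrite allpairs_uniq ?uniq_ints // => -[? ?] [? ?]. Qed.

Lemma mem_grid M p : (p \in grid M) = (`|p.1| <= M)%N && (`|p.2| <= M)%N.
Proof.
case: p => x y; rewrite -!mem_ints; apply/allpairsP/andP => /=.
  by move=> [[x' y'] /= [hx hy [-> ->]]].
by move=> [hx hy]; exists (x, y).
Qed.

Lemma sum_grid M (F : int * int -> nat) :
  (\sum_(p <- grid M) F p = \sum_(x <- ints M) \sum_(y <- ints M) F (x, y))%N.
Proof. by rewrite big_allpairs. Qed.

Definition births_in (n M1 M2 : nat) : nat :=
  (\sum_(0 <= x < M1) \sum_(0 <= y < M2) (birth x.+1 y.+1 == Some n))%N.

(** These are the coefficients of Q. The box loses no birth, because [n < 2 ^ n] and births before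
    [2 ^ n] lie in the block of scale [n]. *)
Definition quadrant_births (n : nat) : nat := births_in n (2 ^ n) (2 ^ n).

Lemma births_in_stable n M1 M2 : (2 ^ n <= M1)%N -> (2 ^ n <= M2)%N ->
  births_in n M1 M2 = quadrant_births n.
Proof.
move=> h1 h2.
have far x y : (2 ^ n <= x)%N || (2 ^ n <= y)%N ->
    (birth x.+1 y.+1 == Some n) = false.
  move=> h; apply/eqP => /birth_in_block /(_ (ltn_expl n (ltnSn 1))); lia.
rewrite /births_in /quadrant_births /births_in (big_cat_nat (n := 2 ^ n)) //=.
rewrite [X in (_ + X)%N]big_nat_cond [X in (_ + X)%N]big1 ?addn0; last first.
  move=> x /andP[/andP[hx _] _]; rewrite big1 // => y _.
  by rewrite far ?hx.
apply: eq_bigr => x _; rewrite (big_cat_nat (n := 2 ^ n)) //=.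
rewrite [X in (_ + X)%N]big_nat_cond [X in (_ + X)%N]big1 ?addn0 //.
by move=> y /andP[/andP[hy _] _]; rewrite far ?hy ?orbT.
Qed.

Lemma quadrant_births0 : quadrant_births 0 = 0%N.
Proof.
rewrite /quadrant_births /births_in expn0 !big_nat1.
by case: eqP => // /birth_positive; lia.
Qed.

(** The axes carry only the seed and the two points [(0, 1)] and [(0, -1)], born at stage 2; the
    four open quadrants are mirror images. *)
Lemma toothpick_addedE n : toothpick_added R n =
  ((n == 1) + 2 * (n == 2) + 4 * quadrant_births n)%N.
Proof.
case: n => [|n].
  by rewrite /toothpick_added fsetDv cardfs0 quadrant_births0.
rewrite /toothpick_added
  (@card_newborn 0 fset0 toothpick_birth _ _ n (grid (2 ^ n.+1))).
- set M := (2 ^ n.+1)%N; have M0 : (0 < M)%N by rewrite expn_gt0.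
  have sum_mirror (F : nat -> nat) :
      (\sum_(x <- ints M) F `|x|%N = F 0 + 2 * \sum_(0 <= i < M) F i.+1)%N.
    by rewrite sum_ints /= mul2n -addnn addnA.
  have axis0 : (\sum_(0 <= i < M) (birth 0 i.+1 == Some n.+1) = (n.+1 == 2))%N.
    rewrite -(prednK M0) big_nat_recl // big1 ?addn0.
      by rewrite birth_axis // (inj_eq Some_inj) eq_sym.
    by move=> i _; rewrite birth_axis.
  rewrite sum_grid /toothpick_birth /=.
  rewrite (sum_mirror
    (fun x => \sum_(y <- ints M) (birth x `|y| == Some n.+1))%N).
  rewrite (sum_mirror (fun y => (birth 0 y == Some n.+1) : nat)) axis0.
  under eq_bigr => x _.
    rewrite (sum_mirror (fun y => (birth x.+1 y == Some n.+1) : nat)).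
    rewrite birth_row0 //.
    over.
  rewrite -big_distrr /= -[X in (2 * (2 * X))%N]/(births_in n.+1 M M).
  rewrite births_in_stable // birth_axis //= mulnA.
  by rewrite (inj_eq Some_inj) eq_sym.
- exact: uniq_grid.
- move=> [x y] /birth_in_block /(_ (ltn_expl _ (ltnSn 1))).
  by rewrite mem_grid /=; lia.
- by move=> p; rewrite in_fset0.
- exact: toothpick_represents.
- exact: toothpick_represents.
Qed.

Lemma corner_addedE n : corner_added R n =
  ((n == 1) + (n == 2) + 2 * quadrant_births n +
   quadrant_births n.+1 * (0 < n))%N.
Proof.
case: n => [|n].
  by rewrite /corner_added fsetDv cardfs0 quadrant_births0 ltnn !muln0.
(* The exponent is [n.+2] because the fourth quadrant at stage [n.+1] shows births of time
   [n.+2]. *)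
set M := (2 ^ n.+2)%N; have M0 : (0 < M)%N by rewrite expn_gt0.
have ltM : (n.+2 < M)%N by apply: ltn_expl.
have MM : (2 ^ n.+1 <= M)%N by rewrite leq_exp2l.
rewrite /corner_added
  (@card_newborn 1 [fset half_toothpick R]%fset corner_birth _ _ n (grid M)).
- have predE o : (omap predn o == Some n.+1) = (o == Some n.+2).
    by case: o => [m|] //=; rewrite !(inj_eq Some_inj); lia.
  have axis0 : (\sum_(0 <= i < M) (birth 0 i.+1 == Some n.+1) = (n.+1 == 2))%N.
    rewrite -(prednK M0) big_nat_recl // big1 ?addn0.
      by rewrite birth_axis // (inj_eq Some_inj) eq_sym.
    by move=> i _; rewrite birth_axis.
  have upper K x :
    (\sum_(0 <= i < K) (corner_birth (x, i.+1 : int) == Some n.+1) =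
      \sum_(0 <= i < K) (birth `|x| i.+1 == Some n.+1))%N.
    by case: x.
  rewrite sum_grid; under eq_bigr do rewrite sum_ints upper.
  rewrite !big_split /= sum_ints.
  rewrite [X in (_ + X + _)%N]sum_ints [X in (_ + X)%N]sum_ints.
  rewrite axis0 birth_axis //= (inj_eq Some_inj).
  (* The column [x = 0] and the columns [x > 0] below the x-axis make up one full rotated open
     quadrant. *)
  have -> : (\sum_(0 <= i < M) (omap predn (birth i.+1 1) == Some n.+1) +
      \sum_(0 <= i < M) \sum_(0 <= j < M)
        (omap predn (birth j.+1 i.+2) == Some n.+1) = births_in n.+2 M M.+1)%N.
    rewrite exchange_big_nat /= -big_split /=; apply: eq_bigr => i _.
    rewrite [RHS]big_nat_recl // predE; congr (_ + _)%N.
    by apply: eq_bigr => j _; rewrite predE.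
  rewrite births_in_stable //.
  rewrite -![(\sum_(0 <= i < M) \sum_(0 <= j < M) (birth _ _ == _))%N]
    /(births_in _ M M).
  rewrite !births_in_stable //.
  have -> : (\sum_(0 <= i < M) (birth i.+1 0 == Some n.+1) = 0)%N.
    by rewrite big1 // => i _; rewrite birth_row0.
  rewrite [X in (_ + (_ + X))%N]big1; last by move=> i _; rewrite big1.
  by lia.
- exact: uniq_grid.
- move=> [x [v|v]] /=.
    move=> E; have : birth `|x| v = Some n.+1 by case: (x) E.
    move=> /birth_in_block /(_ (ltn_trans (ltnSn _) ltM)).
    by rewrite mem_grid /=; lia.
  case: x => [u|//]; case E: (birth _ _) => [m|] //= [mE].
  have mn : m = n.+2 by lia.
  by subst m; have := birth_in_block E ltM; rewrite mem_grid /=; lia.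
- move=> p; rewrite in_fset1; apply/eqP => /(congr1 (@halflength R)).
  by rewrite /halflength /=; lra.
- exact: corner_represents.
- exact: corner_represents.
Qed.

End Counting.

(** * Power series *)

Section Series.
Variable A : comNzRingType.
Implicit Types f g l : fps A.
Local Notation X := (fpsX A).

Lemma coef_fpsD f g n : (f + g) n = f n + g n.
Proof. by []. Qed.

Lemma coef_fpsN f n : (- f) n = - f n.
Proof. by []. Qed.

Lemma coef_fpsMn f m n : (f *+ m) n = f n *+ m.
Proof. by elim: m => [//|m IH]; rewrite !mulrS -IH. Qed.

Lemma coef_fps_sum I (r : seq I) (P : pred I) (F : I -> fps A) n :
  (\sum_(i <- r | P i) F i) n = \sum_(i <- r | P i) F i n.
Proof. by elim/big_rec2: _ => // i y1 y2 _ <-. Qed.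

Lemma coef_fpsXM f n : (X * f) n = if n is m.+1 then f m else 0.
Proof.
rewrite /GRing.mul /=; case: n => [|n].
  by rewrite big_ord_recl big_ord0 /= mul0r addr0.
rewrite big_ord_recl big_ord_recl /= mul0r add0r mul1r big1 ?addr0.
  by rewrite /bump /= subn1.
by move=> i _; rewrite /= mul0r.
Qed.

Lemma fpsXM_inj : injective ( *%R X).
Proof.
move=> f g fg; apply: fpsP => n.
by have := congr1 (fun h : fps A => h n.+1) fg; rewrite !coef_fpsXM.
Qed.

Lemma coef_fpsXnM f m n : (X ^+ m * f) n = if (n < m)%N then 0 else f (n - m)%N.
Proof.
elim: m f n => [|m IH] f n; first by rewrite expr0 mul1r subn0.
by rewrite exprS -mulrA coef_fpsXM; case: n => // n; rewrite IH.
Qed.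

Lemma coef_fpsXn m n : (X ^+ m) n = (n == m)%:R.
Proof.
rewrite -[X ^+ m]mulr1 coef_fpsXnM; case: ltngtP => // h.
  by rewrite /= subn_eq0 leqNgt h.
by rewrite h subnn.
Qed.

Lemma fps_cvg_cst l : fps_cvg (fun=> l) l.
Proof. by move=> n; exists 0%N. Qed.

Lemma fps_cvg_shift u l : fps_cvg u l <-> fps_cvg (fun n => u n.+1) l.
Proof.
split=> ul n; have [N uN] := ul n.
  by exists N => m Nm; apply: uN; apply: leqW.
by exists N.+1 => -[//|m] Nm; apply: uN.
Qed.

Lemma fps_cvgD u v l m : fps_cvg u l -> fps_cvg v m ->
  fps_cvg (fun n => u n + v n) (l + m).
Proof.
move=> ul vm n; have [N1 uN] := ul n; have [N2 vN] := vm n.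
exists (maxn N1 N2) => k; rewrite geq_max => /andP[k1 k2].
by rewrite !coef_fpsD uN ?vN.
Qed.

Lemma fps_cvgM u v l m : fps_cvg u l -> fps_cvg v m ->
  fps_cvg (fun n => u n * v n) (l * m).
Proof.
have below w k : fps_cvg w k -> forall n,
    exists N, forall j i, (N <= j)%N -> (i <= n)%N -> w j i = k i.
  move=> wk; elim=> [|n [N1 wN1]].
    have [N wN] := wk 0%N; exists N => j i jN.
    by rewrite leqn0 => /eqP ->; apply: wN.
  have [N2 wN2] := wk n.+1; exists (maxn N1 N2) => j i.
  rewrite geq_max => /andP[j1 j2]; rewrite leq_eqVlt => /orP[/eqP ->|].
    exact: wN2.
  by rewrite ltnS; apply: wN1.
move=> /below ul /below vm n; have [N1 uN] := ul n; have [N2 vN] := vm n.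
exists (maxn N1 N2) => k; rewrite geq_max => /andP[k1 k2].
apply: eq_bigr => i _; rewrite uN ?vN ?leq_subr //.
by have := ltn_ord i; rewrite ltnS.
Qed.

Lemma stationary_fps_cvg (u : nat -> fps A) :
  (forall N n, (n < N)%N -> u N.+1 n = u N n) -> exists l, fps_cvg u l.
Proof.
move=> st; exists (Fps (fun n => u n.+1 n)) => n; exists n.+1.
elim=> // m IH; rewrite leq_eqVlt => /orP[/eqP [<-]//|].
by rewrite ltnS => nm; rewrite st // IH.
Qed.

Lemma coef_fpsMz f (c : int) n : (f *~ c) n = f n *~ c.
Proof.
by case: c => m; rewrite ?NegzE ?mulrNz ?coef_fpsN -pmulrn coef_fpsMn.
Qed.

(** The inverse is the geometric series with ratio [X *~ c]. *)
Lemma unit_1subXMz (c : int) : 1 - X *~ c \is a GRing.unit.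
Proof.
apply/unitrPr; exists (Fps (fun n => c%:~R ^+ n)).
apply: fpsP => n; rewrite mulrBl mul1r mulrzAl.
rewrite coef_fpsD coef_fpsN coef_fpsMz coef_fpsXM /=.
case: n => [|n]; first by rewrite mul0rz subr0.
by rewrite exprSr mulrzr subrr.
Qed.

End Series.

(** * Recursion for the generating polynomials of the blocks *)

Section QuadrantSeries.
Local Notation x := (fpsX int).

Definition monomial (o : option nat) : fps int :=
  if o is Some m then x ^+ m else 0.

Lemma monomial_shift c o : monomial (omap (addn c) o) = x ^+ c * monomial o.
Proof. by case: o => [m|] /=; rewrite ?exprD ?mulr0. Qed.

Lemma coef_monomial o n : monomial o n = (o == Some n)%:R.
Proof. by case: o => [m|] //=; rewrite coef_fpsXn (inj_eq Some_inj) eq_sym. Qed.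

(** Both axes are left out, but row [N] belongs to the block. *)
Definition block_series (N : nat) (G : nat -> nat -> option nat) : fps int :=
  \sum_(1 <= a < N) \sum_(1 <= b < N.+1) monomial (G a b).

Lemma block_axis k a b : (a * b = 0)%N -> block k a b =
  if (a, b) == (0%N, 0%N) then Some 1%N
  else if (a, b) == (0%N, 1%N) then Some 2%N else None.
Proof.
move=> ab; case: (boolP ((a < 2 ^ k)%N && (b <= 2 ^ k)%N)).
  by move=> /andP[ak bk]; rewrite -(birthE ak bk) birth_axis.
move=> far; rewrite block_out; last by lia.
have := expn_gt0 2 k => k0.
by case: a b ab far => [|a] [|[|b]] //=; lia.
Qed.

(** The reflected and rotated copies contribute only their open parts. The translate also
    contributes its two axis points born at 1 and 2, which are interior to the new block: hence
    [x + x ^+ 2]. *)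
Lemma block_series_quadruple k
    (N := (2 ^ k)%N) (Q := block_series N (block k)) :
  block_series (2 * N) (block k.+1) =
  Q + x ^+ (2 * N) * (x + x ^+ 2 + Q + Q) + x ^+ (2 * N - 1) * Q.
Proof.
rewrite /=; set G := block k; have N0 : (0 < N)%N by rewrite expn_gt0.
have out a b : (N <= a)%N || (N < b)%N -> G a b = None by exact: block_out.
rewrite /block_series (big_cat_nat (n := N)) /=; try lia.
have west : \sum_(1 <= a < N) \sum_(1 <= b < (2 * N).+1)
    monomial (quadruple N G a b) = Q + x ^+ (2 * N) * Q.
  rewrite [X in _ + _ * X]big_nat_rev big_distrr -big_split /=.
  apply: eq_big_nat => a /andP[a1 aN].
  rewrite (big_cat_nat (n := N.+1)) /=; try lia.
  congr (_ + _).
    by apply: eq_big_nat => b /andP[b1 bN]; rewrite quadruple_old.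
  rewrite -[N.+1]add1n big_addn (_ : (2 * N).+1 - N = N.+1)%N; last by lia.
  rewrite mulr_sumr; apply: eq_big_nat => b /andP[b1 bN].
  by rewrite -monomial_shift (@quadruple_nw _ _ _ _ (1 + N - a.+1) b) //; lia.
have ne : \sum_(0 <= a < N) \sum_(1 <= b < N.+1) monomial (G a b) = x ^+ 2 + Q.
  rewrite big_ltn //; congr (_ + _).
  rewrite big_ltn // big_nat_cond big1 ?addr0.
    by rewrite /G block_axis.
  move=> b /andP[/andP[b1 bN] _]; rewrite /G block_axis //.
  by case: b b1 {bN} => [|[|b]].
have bottom : \sum_(0 <= a < N) monomial (G a 0) = x.
  rewrite big_ltn // big_nat_cond big1 ?addr0.
    by rewrite /G block_axis.
  move=> a /andP[/andP[a1 aN] _]; rewrite /G block_axis ?muln0 //.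
  by case: a a1 {aN}.
have se : \sum_(0 <= a < N) \sum_(1 <= b < N) monomial (G b a.+1) = Q.
  by rewrite exchange_big_nat /=; apply: eq_big_nat => b _; rewrite big_add1.
have east : \sum_(N <= a < 2 * N) \sum_(1 <= b < (2 * N).+1)
    monomial (quadruple N G a b) =
    x ^+ (2 * N - 1) * Q + x ^+ (2 * N) * x + x ^+ (2 * N) * (x ^+ 2 + Q).
{ rewrite -{1}[N]add0n big_addn (_ : 2 * N - N = N)%N; last by lia.
  transitivity (\sum_(0 <= a < N)
      (x ^+ (2 * N - 1) * (\sum_(1 <= b < N) monomial (G b a.+1)) +
       x ^+ (2 * N) * monomial (G a 0%N) +
       x ^+ (2 * N) * (\sum_(1 <= b < N.+1) monomial (G a b)))); last first.
    by rewrite !big_split -!big_distrr /= se bottom ne.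
  apply: eq_big_nat => a /andP[_ aN].
  rewrite (big_cat_nat (n := N)) /=; try lia.
  rewrite (big_ltn (m := N)); try lia.
  rewrite addrA; congr (_ + _ + _).
  - rewrite big_nat_rev mulr_sumr; apply: eq_big_nat => b /andP[b1 bN].
    by rewrite -monomial_shift (@quadruple_se _ _ _ _ a b) //; lia.
  - by rewrite -monomial_shift (@quadruple_ne _ _ _ _ a 0) //; lia.
  - rewrite -[N.+1]add1n big_addn (_ : (2 * N).+1 - N = N.+1)%N; last by lia.
    rewrite mulr_sumr; apply: eq_big_nat => b /andP[b1 bN].
    by rewrite -monomial_shift (@quadruple_ne _ _ _ _ a b) //; lia. }
by rewrite west east; ring.
Qed.

(** The new factor F satisfies F - 1 = (1 + 2x) x^(2N-1) with N = 2^k. Therefore adding x^2 (1 + x)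
    to (1 + 2x) Q turns the affine recursion into multiplication by F. *)
Lemma block_series_prod k :
  (1 + 2 * x) * block_series (2 ^ k) (block k) =
  x ^+ 2 * (1 + x) * (\prod_(1 <= j < k.+1) toothpick_factor j - 1).
Proof.
elim: k => [|k IH].
  by rewrite /block_series !big_geq // subrr !mulr0.
rewrite expnS block_series_quadruple big_nat_recr //=.
set N := (2 ^ k)%N in IH *; have N0 : (0 < N)%N by rewrite expn_gt0.
rewrite /toothpick_factor expnS -/N.
set Q := block_series N _ in IH *; set P := \prod_(1 <= j < k.+1) _ in IH *.
have -> : x ^+ (2 * N) = x * x ^+ (2 * N - 1).
  by rewrite -exprS; congr (_ ^+ _); lia.
set w := x ^+ (2 * N - 1).
have -> : (1 + 2 * x) * (Q + x * w * (x + x ^+ 2 + Q + Q) + w * Q) =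
    ((1 + 2 * x) * Q) * (1 + w + 2 * (x * w)) +
    (1 + 2 * x) * (x * w * (x + x ^+ 2)).
  by ring.
by rewrite IH; ring.
Qed.

End QuadrantSeries.

(** * Passage to the limit and the three generating functions *)

Section GeneratingFunctions.
Local Notation x := (fpsX int).

Definition quadrant_series : fps int := genfun quadrant_births.

Lemma block_series_cvg :
  fps_cvg (fun k => block_series (2 ^ k) (block k)) quadrant_series.
Proof.
(* One scale beyond [n]: the columns of the block stop at [2 ^ k - 1], which must reach [2 ^ n]. *)
move=> n; exists n.+1 => k nk.
have kn : (2 ^ n.+1 <= 2 ^ k)%N by rewrite leq_exp2l.
have n2k : (n < 2 ^ k)%N by have := ltn_expl n.+1 (ltnSn 1); lia.
have n0 : (0 < 2 ^ n)%N by rewrite expn_gt0.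
rewrite expnS in kn.
rewrite /= -(@births_in_stable _ (2 ^ k).-1 (2 ^ k)); try lia.
rewrite /births_in -natz natr_sum coef_fps_sum big_add1.
apply: eq_bigr => a _; rewrite natr_sum coef_fps_sum big_add1.
by apply: eq_bigr => b _; rewrite coef_monomial (birth_block_eq _ _ n2k).
Qed.

Lemma toothpick_prod_cvg : exists P, is_infprod 1 toothpick_factor P.
Proof.
apply: stationary_fps_cvg => -[//|N] n nN.
set P := \prod_(1 <= k < N.+1) toothpick_factor k.
have -> : \prod_(1 <= k < N.+2) toothpick_factor k = P * toothpick_factor N.+1.
  by rewrite big_nat_recr.
have ltN : (N.+1 < 2 ^ N.+1)%N by exact: ltn_expl.
(* In this form the factor visibly leaves all coefficients below [2 ^ N.+1 - 1] unchanged. *)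
have -> : toothpick_factor N.+1 = 1 + x ^+ (2 ^ N.+1 - 1) * (1 + 2 * x).
  rewrite /toothpick_factor mulrDr mulr1 mulrCA -exprSr addrA.
  by congr (_ + _ * _ ^+ _); lia.
rewrite [P * _]mulrDr mulr1 mulrCA coef_fpsD coef_fpsXnM.
by rewrite ifT ?addr0 //; lia.
Qed.

Lemma quadrant_seriesE P : is_infprod 1 toothpick_factor P ->
  (1 + 2 * x) * quadrant_series = x ^+ 2 * (1 + x) * (P - 1).
Proof.
move=> /fps_cvg_shift Pcvg.
apply: (fps_cvg_unique
  (u := fun k => (1 + 2 * x) * block_series (2 ^ k) (block k))).
  exact: fps_cvgM (fps_cvg_cst _) block_series_cvg.
under [X in fps_cvg X]funext => k do rewrite block_series_prod.
apply: fps_cvgM (fps_cvg_cst _) _.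
exact: fps_cvgD Pcvg (fps_cvg_cst _).
Qed.

Lemma toothpick_prod0 P : is_infprod 1 toothpick_factor P ->
  is_infprod 0 toothpick_factor (2 * (1 + x) * P).
Proof.
move=> /fps_cvg_shift Pcvg; apply/fps_cvg_shift.
under [X in fps_cvg X]funext => k do rewrite big_ltn //.
have -> : toothpick_factor 0 = 2 * (1 + x).
  by rewrite /toothpick_factor expn0 subnn expr0 expr1; ring.
exact: fps_cvgM (fps_cvg_cst _) Pcvg.
Qed.

Lemma genfun_toothpick_added (R : realType) :
  genfun (toothpick_added R) = x + 2 * x ^+ 2 + 4 * quadrant_series.
Proof.
rewrite !mulr_natl; apply: fpsP => n.
rewrite 2!coef_fpsD !coef_fpsMn coef_fpsXn /= toothpick_addedE; lia.
Qed.

(** This makes the term Q/x of the corner series agree with c(0) = 0. *)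
Lemma quadrant_births1 : quadrant_births 1 = 0%N.
Proof.
apply: big1 => a _; apply: big1 => b _; case: eqP => // E.
have : (a.+1 : int, b.+1 : int) = (0, 0).
  apply: (first_born toothpick_birth_gt0).
    by move=> p /toothpick_birth_spreads; left.
  by rewrite /toothpick_birth /= E.
by [].
Qed.

Lemma genfun_corner_added (R : realType) :
  x * genfun (corner_added R) =
  x ^+ 2 * (1 + x) + (1 + 2 * x) * quadrant_series.
Proof.
rewrite mulrDr mulr1 -exprSr mulrDl mul1r -mulrA mulr_natl.
apply: fpsP => n; rewrite 3!coef_fpsD coef_fpsMn !coef_fpsXn !coef_fpsXM.
case: n => [|n] /=; first by rewrite quadrant_births0.
rewrite corner_addedE; case: n => [|n]; last by lia.
by rewrite quadrant_births0 quadrant_births1.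
Qed.

Lemma genfun_toothpick_total (R : realType) :
  (1 - x) * genfun (toothpick_total R) = genfun (toothpick_added R).
Proof.
rewrite mulrBl mul1r; apply: fpsP => n.
rewrite coef_fpsD coef_fpsN coef_fpsXM /= /toothpick_total.
case: n => [|n]; first by rewrite big_nat1 subr0.
by rewrite big_nat_recr //= PoszD; lia.
Qed.

End GeneratingFunctions.

Theorem theorem7 (R : realType) :
  let x := fpsX int in
  exists P0 P1 : fps int,
    [/\ is_infprod 0 toothpick_factor P0,
        is_infprod 1 toothpick_factor P1 &
    [/\ genfun (corner_added R) = x * (1 + x) * P1,
        genfun (toothpick_added R) =
          x / (1 + 2 * x) * (1 + 4 * x * (1 + x) * P1),
        genfun (toothpick_added R) = x / (1 + 2 * x) * (1 + 2 * x * P0) &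
        genfun (toothpick_total R) =
          x / ((1 - x) * (1 + 2 * x)) * (1 + 2 * x * P0)]].
Proof.
move=> x; have [P1 hP1] := toothpick_prod_cvg.
have QE := quadrant_seriesE hP1.
have u2 : 1 + 2 * x \is a GRing.unit.
  have -> : 1 + 2 * x = 1 - x *~ (- 2%:Z) by rewrite mulrNz opprK mulr_natl.
  exact: unit_1subXMz.
have u1 : 1 - x \is a GRing.unit by rewrite -[x]mulr1z; apply: unit_1subXMz.
(* Since (x + 2x^2)(1 + 2x) = x + 4x^2 (1 + x), the axis terms absorb the -1 of [P1 - 1]. *)
have T : genfun (toothpick_added R) * (1 + 2 * x) =
    x * (1 + 4 * x * (1 + x) * P1).
  rewrite genfun_toothpick_added mulrDl -[4 * _ * _]mulrA.
  rewrite [_ * (1 + _)]mulrC -/x.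
  by rewrite [quadrant_series * _]mulrC QE -/x; ring.
have T1 : genfun (toothpick_added R) =
    x / (1 + 2 * x) * (1 + 4 * x * (1 + x) * P1).
  by apply: (mulIr u2); rewrite T [RHS]mulrAC divrK.
have E : 1 + 2 * x * (2 * (1 + x) * P1) = 1 + 4 * x * (1 + x) * P1 by ring.
exists (2 * (1 + x) * P1), P1; split=> //; first exact: toothpick_prod0.
split=> //.
- by apply: fpsXM_inj; rewrite genfun_corner_added QE; rewrite -/x; ring.
- by rewrite E.
- apply: (mulrI u1); rewrite genfun_toothpick_total E T1.
  rewrite [RHS]mulrA; congr (_ * _).
  by rewrite invrM // [RHS]mulrC [x * (_ * _)]mulrA divrK.
Qed.
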